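(* Let $\mathsf L$ be a logic obtained by adding to the language of $\mathbf{CPL}^+$ new atoms having the empty team property (e.g. independence atoms, giving $\mathbf{PI}^+$, or inclusion atoms, giving $\mathbf{PInc}^+$). For any formulas $\phi$ and $\psi$ in the language of $\mathsf L$: if $\phi\models\psi$ then $\phi\vdash\psi$ in the natural deduction system of $\mathsf L$.
   Context: $\mathbf{CPL}^+$ formulas: $\phi::=p_i\mid\neg p_i\mid\bot\mid\mathrm{NE}\mid\phi\wedge\phi\mid\phi\otimes\phi$. A valuation on $N\subseteq\mathbb N$ is $s:N\to\{0,1\}$, a team on $N$ a set of such. Semantics: $X\models p_i$ iff $s(i)=1$ for all $s\in X$; $X\models\neg p_i$ iff $s(i)=0$ for all $s\in X$; $X\models\bot$ iff $X=\emptyset$; $X\models\mathrm{NE}$ iff $X\ne\emptyset$; $\wedge$ as usual; $X\models\phi\otimes\psi$ iff $X=Y\cup Z$ with $Y\models\phi$, $Z\models\psi$. Each new atom $\alpha$ involves finitely many variables and has a team semantics depending only on the restriction of the team to the indices of these variables, with $\emptyset\models\alpha$ (e.g. $X\models p_{\vec i}\perp p_{\vec j}$ iff for all $s,s'\in X$ some $s''\in X$ has $s''(\vec i)=s(\vec i)$, $s''(\vec j)=s'(\vec j)$; $X\models p_{\vec i}\subseteq p_{\vec j}$ iff for all $s\in X$ some $s'\in X$ has $s(\vec i)=s'(\vec j)$). $\phi\models\psi$: every team satisfying $\phi$ satisfies $\psi$. Classical formulas: built from $p_i,\neg p_i,\bot$ by $\wedge,\otimes$. $p_i^1=p_i$,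 $p_i^0=\neg p_i$; empty $\otimes$ is $\bot$; for a team $X$ on finite $N=\{i_1,\dots,i_n\}$, $\Theta^*_X=\bigotimes_{s\in X}(p_{i_1}^{s(i_1)}\wedge\dots\wedge p_{i_n}^{s(i_n)}\wedge\mathrm{NE})$. Formulas are strings numbered from the left; $[\psi,m]$ is the occurrence of subformula $\psi$ starting at symbol $m$, $\phi(\beta/[\psi,m])$ replaces it by $\beta$. Natural deduction system of $\mathsf L$ (derivations with discharge; no substitution rule): Axiom $p_i\otimes\neg p_i$ (each $i$). Rules: standard $\wedge$-introduction/elimination; from $\phi$ infer $\phi\otimes\psi$ if $\psi$ has no $\mathrm{NE}$; from $\phi$ infer $\phi\otimes\phi$; from $\phi\otimes\psi$ and derivations of $\alpha$ from $\phi$ and from $\psi$ (discharged) infer $\alpha$, provided $\alpha$ and the other undischarged assumptions of the subderivations are classical; from $\phi\otimes\psi$ and a derivation of $\chi$ from $\psi$ (discharged) infer $\phi\otimes\chi$, provided the other undischarged assumptions of that subderivation are classical; from $\phi\otimes\psi$ infer $\psi\otimes\phi$; from $\phi\otimes(\psi\otimes\chi)$ infer $(\phi\otimes\psi)\otimes\chi$; from $p_i\wedge\neg p_i$ infer $\bot$; from $\phi\otimes\bot$ infer $\phi$; from $\bot\wedge\mathrm{NE}$ infer any $\phi$; from $\phi\otimes(\bot\wedge\mathrm{NE})$ infer $\bot\wedge\mathrm{NE}$; from $\Theta^*_X\wedge\Theta^*_Y$ infer $\bot\wedge\mathrm{NE}$ for distinct teams $X,Y$ on the same finite index set; from $\alpha\wedge(\psi\otimes\chi)$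 infer $(\alpha\wedge\psi)\otimes(\alpha\wedge\chi)$ for classical $\alpha$; Strong elimination 1: for a finite $N$ with $Y_1,\dots,Y_k$ all nonempty teams on $N$ and an occurrence $[\mathrm{NE},m]$ in $\phi$: from $\phi$ and derivations of $\theta$ from each $\phi(\Theta^*_{Y_j}/[\mathrm{NE},m])$ (discharged) infer $\theta$; Strong elimination 2: for an occurrence $[\psi,m]$ in $\phi$: from $\phi$ and derivations of $\theta$ from $\phi(\psi\wedge\bot/[\psi,m])$ and from $\phi(\psi\wedge\mathrm{NE}/[\psi,m])$ infer $\theta$; and for each new atom $\alpha$: $\alpha$-introduction: from $\Theta^*_Y$ infer $\alpha$, where $Y$ is a team on a finite index set $N$ (containing the indices of $\alpha$) with $Y\models\alpha$; strong $\alpha$-elimination: for an occurrence $[\alpha,m]$ in $\phi$ and $Y_1,\dots,Y_k$ all teams on a finite $N$ (containing the indices of $\alpha$) satisfying $\alpha$: from $\phi$ and derivations of $\theta$ from each $\phi(\Theta^*_{Y_j}/[\alpha,m])$ (discharged) infer $\theta$. *)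

(* Defs.v *)
From mathcomp Require Import all_boot.
From mathcomp Require Import finmap.
From mathcomp Require Import boolp classical_sets functions cardinality.
From Stdlib Require List.

Set Implicit Arguments.
Unset Strict Implicit.
Unset Printing Implicit Defensive.

Local Open Scope classical_set_scope.

Definition valuation (N : set nat) : Type := N -> bool.
Definition team (N : set nat) : Type := set (valuation N).

(* [value s i] is s(i); the default [false] is returned only for i outside N,
   a case excluded wherever satisfaction is used. *)
Definition value (N : set nat) (s : valuation N) (i : nat) : bool :=
  oapp s false (insub i).

(* Restriction to K, meant for K `<=` N. *)
Definition restrict_val (K N : set nat) (s : valuation N) : valuation K :=
  fun i => value s (val i).
Arguments restrict_val K {N} s.

Definition restrict (K N : set nat) (X : team N) : team K :=
  [set restrict_val K s | s in X].
Arguments restrict K {N} X.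

(* A family of new atoms: the data that determines the logic L. *)
Record atom_family : Type := AtomFamily {
  atom :> Type;
  atom_vars : atom -> {fset nat};
  atom_sat : forall N : set nat, team N -> atom -> Prop;
  atom_locality : forall (a : atom) (N M : set nat) (X : team N) (Y : team M),
    [set` atom_vars a] `<=` N -> [set` atom_vars a] `<=` M ->
    restrict [set` atom_vars a] X = restrict [set` atom_vars a] Y ->
    (atom_sat X a <-> atom_sat Y a);
  atom_empty_team : forall (a : atom) (N : set nat),
    [set` atom_vars a] `<=` N -> atom_sat (set0 : team N) a
}.

(* Negation occurs only in front of a variable, so [NVar i] is a literal with
   no proper subformula. *)
Inductive formula (A : Type) : Type :=
| Var of nat
| NVar of nat
| Bot
| NE
| Atom of A
| And of formula A & formula A
| Tens of formula A & formula A.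

Arguments Var {A}.
Arguments NVar {A}.
Arguments Bot {A}.
Arguments NE {A}.
Arguments Atom {A}.

Declare Scope team_scope.
Delimit Scope team_scope with T.
Bind Scope team_scope with formula.
Notation "a ∧ b" := (And a b) (at level 40, left associativity) : team_scope.
Notation "a ⊗ b" := (Tens a b) (at level 50, left associativity) : team_scope.
Local Open Scope team_scope.

Section Logic.
Variable L : atom_family.
Notation fml := (formula (atom L)).

Fixpoint vars (f : fml) : set nat :=
  match f with
  | Var i | NVar i => [set i]
  | Bot | NE => set0
  | Atom a => [set` atom_vars a]
  | And g h | Tens g h => vars g `|` vars h
  end.

Fixpoint sat (N : set nat) (X : team N) (f : fml) : Prop :=
  match f with
  | Var i => forall s, X s -> value s i = true
  | NVar i => forall s, X s -> value s i = false
  | Bot => X = set0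
  | NE => X <> set0
  | Atom a => atom_sat X a
  | And g h => sat X g /\ sat X h
  | Tens g h => exists Y Z : team N, X = Y `|` Z /\ sat Y g /\ sat Z h
  end.

(* Satisfaction on N is meaningful only if N contains the indices of the
   formula, hence the conditions on N. *)
Definition entails (f g : fml) : Prop :=
  forall (N : set nat) (X : team N),
    vars f `<=` N -> vars g `<=` N -> sat X f -> sat X g.

Fixpoint classical (f : fml) : bool :=
  match f with
  | Var _ | NVar _ | Bot => true
  | NE | Atom _ => false
  | And g h | Tens g h => classical g && classical h
  end.

Fixpoint ne_free (f : fml) : bool :=
  match f with
  | NE => false
  | Var _ | NVar _ | Bot | Atom _ => true
  | And g h | Tens g h => ne_free g && ne_free h
  end.

Definition literal (i : nat) (b : bool) : fml := if b then Var i else NVar i.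

Fixpoint bigTens (fs : seq fml) : fml :=
  match fs with
  | [::] => Bot
  | [:: f] => f
  | f :: fs' => f ⊗ bigTens fs'
  end.

(* Used for finite N only ([fset_set] of an infinite set is empty).  The order
   in which [fset_set] lists N and X is unspecified, but fixed. *)
Definition Theta (N : set nat) (X : team N) : fml :=
  bigTens [seq foldr (@And _) NE
                 [seq literal (val i) (s i) | i <- fset_set [set: N]]
          | s <- fset_set X].

(* One-hole contexts stand for occurrences: an occurrence of f in g is a context
   c with g = fill c f, and fill c h is the result of replacing it by h. *)
Inductive ctx : Type :=
| Hole
| AndL of ctx & fml
| AndR of fml & ctx
| TensL of ctx & fml
| TensR of fml & ctx.

Fixpoint fill (c : ctx) (f : fml) : fml :=
  match c with
  | Hole => f
  | AndL c' g => fill c' f ∧ g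
  | AndR g c' => g ∧ fill c' f
  | TensL c' g => fill c' f ⊗ g
  | TensR g c' => g ⊗ fill c' f
  end.

(* [derives G f]: f has a derivation whose undischarged assumptions are all
   among G.  In [d_tensE] and [d_tensSub], D collects the undischarged
   assumptions of the subderivations other than the discharged ones. *)
Inductive derives : seq fml -> fml -> Prop :=
| d_assumption G f : List.In f G -> derives G f
| d_axiom G i : derives G (Var i ⊗ NVar i)
| d_andI G f g : derives G f -> derives G g -> derives G (f ∧ g)
| d_andEl G f g : derives G (f ∧ g) -> derives G f
| d_andEr G f g : derives G (f ∧ g) -> derives G g
| d_tensI G f g : ne_free g -> derives G f -> derives G (f ⊗ g)
| d_tensW G f : derives G f -> derives G (f ⊗ f)
| d_tensE G D f g a :
    classical a -> List.incl D G -> (forall h, List.In h D -> classical h) ->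
    derives G (f ⊗ g) -> derives (f :: D) a -> derives (g :: D) a ->
    derives G a
| d_tensSub G D f g h :
    List.incl D G -> (forall k, List.In k D -> classical k) ->
    derives G (f ⊗ g) -> derives (g :: D) h -> derives G (f ⊗ h)
| d_tensC G f g : derives G (f ⊗ g) -> derives G (g ⊗ f)
| d_tensA G f g h : derives G (f ⊗ (g ⊗ h)) -> derives G ((f ⊗ g) ⊗ h)
| d_contradiction G i : derives G (Var i ∧ NVar i) -> derives G Bot
| d_botE G f : derives G (f ⊗ Bot) -> derives G f
| d_exfalso G f : derives G (Bot ∧ NE) -> derives G f
| d_bneCtr G f : derives G (f ⊗ (Bot ∧ NE)) -> derives G (Bot ∧ NE)
| d_ThetaCtr G (N : set nat) (X Y : team N) :
    finite_set N -> X <> Y ->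
    derives G (Theta X ∧ Theta Y) -> derives G (Bot ∧ NE)
| d_distr G a f g :
    classical a -> derives G (a ∧ (f ⊗ g)) -> derives G ((a ∧ f) ⊗ (a ∧ g))
| d_strongE1 G (N : set nat) c f :
    finite_set N -> derives G (fill c NE) ->
    (forall Y : team N, Y <> set0 -> derives (fill c (Theta Y) :: G) f) ->
    derives G f
| d_strongE2 G c g f :
    derives G (fill c g) ->
    derives (fill c (g ∧ Bot) :: G) f -> derives (fill c (g ∧ NE) :: G) f ->
    derives G f
| d_atomI G (N : set nat) (Y : team N) (a : atom L) :
    finite_set N -> [set` atom_vars a] `<=` N -> atom_sat Y a ->
    derives G (Theta Y) -> derives G (Atom a)
| d_atomE G (N : set nat) c (a : atom L) f :
    finite_set N -> [set` atom_vars a] `<=` N -> derives G (fill c (Atom a)) ->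
    (forall Y : team N, atom_sat Y a -> derives (fill c (Theta Y) :: G) f) ->
    derives G f.

End Logic.

Lemma value_restrict (K N : set nat) (s : valuation N) i :
  K i -> value (restrict_val K s) i = value s i.
Proof.
move=> Ki; rewrite {1}/value; case: insubP => [j _ <- //|].
by rewrite mem_set.
Qed.

Lemma restrict_agree (K N M : set nat) (X : team N) (Y : team M) s :
  restrict K X = restrict K Y -> X s ->
  exists2 t, Y t & forall i, K i -> value t i = value s i.
Proof.
move=> XY Xs; have : restrict K Y (restrict_val K s) by rewrite -XY; exists s.
case=> t Yt ts; exists t => // i Ki.
by rewrite -(value_restrict t Ki) ts value_restrict.
Qed.

(* Independence atoms, giving PI+. *)
Definition indep_sat (N : set nat) (X : team N) (a : seq nat * seq nat) : Prop :=
  forall s s', X s -> X s' -> exists s'', [/\ X s'',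
    map (value s'') a.1 = map (value s) a.1 &
    map (value s'') a.2 = map (value s') a.2].

Definition indep_vars (a : seq nat * seq nat) : {fset nat} :=
  [fset i in a.1 ++ a.2]%fset.

Lemma indep_varsE (a : seq nat * seq nat) i :
  [set` indep_vars a] i = (i \in a.1 ++ a.2) :> Prop.
Proof. by rewrite /= /indep_vars in_fset. Qed.

Lemma indep_locality (a : seq nat * seq nat) (N M : set nat)
    (X : team N) (Y : team M) :
  [set` indep_vars a] `<=` N -> [set` indep_vars a] `<=` M ->
  restrict [set` indep_vars a] X = restrict [set` indep_vars a] Y ->
  (indep_sat X a <-> indep_sat Y a).
Proof.
move=> _ _; move: N M X Y.
suff impl N M (X : team N) (Y : team M) :
    restrict [set` indep_vars a] X = restrict [set` indep_vars a] Y ->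
    indep_sat X a -> indep_sat Y a.
  by move=> N M X Y XY; split; apply: impl.
move=> XY indX t t' Yt Yt'.
have [s Xs st] := restrict_agree (esym XY) Yt.
have [s' Xs' st'] := restrict_agree (esym XY) Yt'.
have [u [Xu us us']] := indX _ _ Xs Xs'.
have [v Yv vu] := restrict_agree XY Xu.
exists v; split=> //.
  rewrite (_ : map (value t) _ = map (value u) a.1); last rewrite us.
    by apply/eq_in_map => i ia; apply: vu; rewrite indep_varsE mem_cat ia.
  by apply/eq_in_map => i ia; rewrite st // indep_varsE mem_cat ia.
rewrite (_ : map (value t') _ = map (value u) a.2); last rewrite us'.
  by apply/eq_in_map => i ia; apply: vu; rewrite indep_varsE mem_cat ia orbT.
by apply/eq_in_map => i ia; rewrite st' // indep_varsE mem_cat ia orbT.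
Qed.

Lemma indep_empty_team (a : seq nat * seq nat) (N : set nat) :
  [set` indep_vars a] `<=` N -> indep_sat (set0 : team N) a.
Proof. by move=> _ s s' []. Qed.

Definition independence_atoms : atom_family :=
  AtomFamily indep_locality indep_empty_team.

(* Inclusion atoms between index sequences of equal length, giving PInc+. *)
Definition incl_atom : Type := {ab : seq nat * seq nat | size ab.1 == size ab.2}.

Definition incl_sat (N : set nat) (X : team N) (a : incl_atom) : Prop :=
  forall s, X s -> exists2 s', X s' &
    map (value s) (val a).1 = map (value s') (val a).2.

Definition incl_vars (a : incl_atom) : {fset nat} := indep_vars (val a).

Lemma incl_locality (a : incl_atom) (N M : set nat) (X : team N) (Y : team M) :
  [set` incl_vars a] `<=` N -> [set` incl_vars a] `<=` M ->
  restrict [set` incl_vars a] X = restrict [set` incl_vars a] Y ->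
  (incl_sat X a <-> incl_sat Y a).
Proof.
move=> _ _; move: N M X Y.
suff impl N M (X : team N) (Y : team M) :
    restrict [set` incl_vars a] X = restrict [set` incl_vars a] Y ->
    incl_sat X a -> incl_sat Y a.
  by move=> N M X Y XY; split; apply: impl.
move=> XY incX t Yt.
have [s Xs st] := restrict_agree (esym XY) Yt.
have [u Xu us] := incX _ Xs.
have [v Yv vu] := restrict_agree XY Xu.
exists v => //.
rewrite (_ : map (value v) _ = map (value u) (val a).2); last first.
  by apply/eq_in_map => i ia; apply: vu; rewrite indep_varsE mem_cat ia orbT.
rewrite -us; apply/eq_in_map => i ia.
by rewrite st // indep_varsE mem_cat ia.
Qed.

Lemma incl_empty_team (a : incl_atom) (N : set nat) :
  [set` incl_vars a] `<=` N -> incl_sat (set0 : team N) a.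
Proof. by move=> _ s []. Qed.

Definition inclusion_atoms : atom_family :=
  AtomFamily incl_locality incl_empty_team.

(* Main.v *)
(** Fix a finite index set [N] containing the variables of both formulas.  The
    strong elimination rules, applied inside an arbitrary context, reduce a
    derivation from [phi] to derivations from the formulas [Theta X], for the
    finitely many teams [X] on [N] satisfying [phi].  Conversely [Theta X]
    derives every formula true in [X].  Both halves are inductions on the
    formula; the tensor case rests on the interderivability of
    [Theta (Y `|` Z)] and [Theta Y ⊗ Theta Z], which holds because the
    disjuncts of [Theta] are idempotent for [⊗]. *)
Require Import Defs.
From mathcomp Require Import all_boot.
From mathcomp Require Import finmap.
From mathcomp Require Import boolp classical_sets functions cardinality.

Set Implicit Arguments.
Unset Strict Implicit.
Unset Printing Implicit Defensive.

Local Open Scope classical_set_scope.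
Local Open Scope team_scope.

(** * Finiteness of index sets and teams *)

Lemma finite_setT_sub (N : set nat) : finite_set N -> finite_set [set: N].
Proof.
move=> finN.
have -> : [set: N] = (fun i : N => val i) @^-1` N.
  by apply/seteqP; split=> // -[i Ni] _ /=; apply: set_mem.
by apply: finite_preimage => // i j _ _; apply: val_inj.
Qed.

(** A valuation is determined by the set of indices it makes true, so the valuations on a finite [N]
    inject into a finite power set. *)
Lemma finite_team (N : set nat) (X : team N) : finite_set N -> finite_set X.
Proof.
move=> /finite_setT_sub finN; set D := fset_set [set: N].
pose f (s : valuation N) : {fset N} := [fset i in D | s i]%fset.
have finf : finite_set (f @^-1` [set` fpowerset D]).
  apply: finite_preimage; last exact: finite_fset.
  move=> s t _ _ /fsetP st; apply/funext => i; have := st i.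
  have Di : i \in D by rewrite /D in_fset_set // in_setT.
  by rewrite !inE /= Di.
apply: sub_finite_set finf => s _ /=.
by rewrite fpowersetE; apply/fsubsetP => i; rewrite !inE => /andP[].
Qed.

Lemma value_val (N : set nat) (s : valuation N) (i : N) : value s (val i) = s i.
Proof. by rewrite /value valK. Qed.

Lemma finite_vars (L : atom_family) (f : formula (atom L)) :
  finite_set (vars f).
Proof.
by elim: f => [i|i|||a|g IHg h IHh|g IHg h IHh] /=;
  rewrite ?finite_setU; do ?[exact: finite_set1|exact: finite_set0|
  exact: finite_fset].
Qed.

(** * Derived rules and replacement inside contexts *)

Section Derivability.
Variable L : atom_family.
Notation fml := (formula (atom L)).
Implicit Types (f g h : fml) (c d : ctx L).

(* Quantifying over all [G] builds in cut and weakening, so that neither has to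
   be proved admissible. *)
Definition yields f g : Prop := forall G, derives G f -> derives G g.

Lemma yields_derives f g G : yields f g -> derives (f :: G) g.
Proof. by apply; apply: d_assumption; left. Qed.

Lemma yields_trans g f h : yields f g -> yields g h -> yields f h.
Proof. by move=> fg gh G /fg/gh. Qed.

Lemma yields_and f f' g g' :
  yields f f' -> yields g g' -> yields (f ∧ g) (f' ∧ g').
Proof.
by move=> ff' gg' G H; apply: d_andI; [apply/ff'/d_andEl/H|apply/gg'/d_andEr/H].
Qed.

(** Since [yields] holds over every list of assumptions, the subderivation needs only its discharged
    one, and the side condition on classical assumptions is vacuous. *)
Lemma yields_tensr f g g' : yields g g' -> yields (f ⊗ g) (f ⊗ g').
Proof.
by move=> gg' G H; apply: (@d_tensSub _ _ nil) H _ => //; apply: yields_derives.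
Qed.

Lemma yields_tensl f f' g : yields f f' -> yields (f ⊗ g) (f' ⊗ g).
Proof. by move=> ff' G /d_tensC/(yields_tensr ff')/d_tensC. Qed.

Lemma yields_tens f f' g g' :
  yields f f' -> yields g g' -> yields (f ⊗ g) (f' ⊗ g').
Proof. by move=> ff' gg' G /(yields_tensl ff')/(yields_tensr gg'). Qed.

(** Only the other direction of associativity is a rule; two uses of it, interleaved with
    commutations, give this one. *)
Lemma yields_tens_assoc f g h : yields ((f ⊗ g) ⊗ h) (f ⊗ (g ⊗ h)).
Proof. by move=> G /d_tensC/d_tensA/d_tensC/d_tensA/d_tensC. Qed.

Lemma yields_tensE f g a :
  classical a -> yields f a -> yields g a -> yields (f ⊗ g) a.
Proof.
by move=> ca fa ga G H; apply: (@d_tensE _ _ nil) H _ _ => //;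
  apply: yields_derives.
Qed.

Lemma yields_bot f : ne_free f -> yields Bot f.
Proof. by move=> nf G H; apply/d_botE/d_tensC/d_tensI. Qed.

Lemma yields_fill c f g : yields f g -> yields (fill c f) (fill c g).
Proof.
move=> fg; elim: c => //= [c IH h|h c IH|c IH h|h c IH].
- exact: yields_and.
- exact: yields_and.
- exact: yields_tensl.
- exact: yields_tensr.
Qed.

(** The contradiction passes outward one connective at a time; at a tensor this is the rule
    [d_bneCtr]. *)
Lemma yields_fill_absurd c : yields (fill c (Bot ∧ NE)) (Bot ∧ NE).
Proof.
elim: c => //= [c IH h|h c IH|c IH h|h c IH] G H.
- exact/IH/(d_andEl H).
- exact/IH/(d_andEr H).
- by apply/d_bneCtr/(yields_tensr IH)/d_tensC/H.
- by apply/d_bneCtr/(yields_tensr IH)/H.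
Qed.

Lemma absurd_fill c f g : yields f (Bot ∧ NE) -> yields (fill c f) g.
Proof. by move=> fA G /(yields_fill fA)/yields_fill_absurd/d_exfalso. Qed.

Lemma distr_absurd a f g :
  classical a -> yields (a ∧ g) (Bot ∧ NE) ->
  yields (a ∧ (f ⊗ g)) (Bot ∧ NE).
Proof. by move=> ca ag G /(d_distr ca)/(yields_tensr ag)/d_bneCtr. Qed.

(** Tensor elimination does not apply, as [NE] is not classical. Instead strong elimination 2 splits
    the whole formula: conjoined with [NE] it is immediate, and [Bot] distributes over the tensor,
    making the right component contradictory. *)
Lemma yields_tensNE f g : yields g NE -> yields (f ⊗ g) NE.
Proof.
move=> gNE G H; apply: (@d_strongE2 _ _ (Hole L)) H _ _ => /=.
  apply: yields_derives => G' H.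
  have /distr_absurd Hd : yields (Bot ∧ g) (Bot ∧ NE) by apply: yields_and.
  by apply/d_andEr/(Hd f isT)/d_andI; [apply: d_andEr H|apply: d_andEl H].
by apply: d_andEr; apply: d_assumption; left.
Qed.

(** Composition lets an elimination act on a component of the formula in the hole of a given
    context. *)
Fixpoint ctx_comp c d : ctx L :=
  match c with
  | Hole => d
  | AndL c' g => AndL (ctx_comp c' d) g
  | AndR g c' => AndR g (ctx_comp c' d)
  | TensL c' g => TensL (ctx_comp c' d) g
  | TensR g c' => TensR g (ctx_comp c' d)
  end.

Lemma fill_comp c d f : fill (ctx_comp c d) f = fill c (fill d f).
Proof. by elim: c => //= [c ->|g c ->|c ->|g c ->]. Qed.

(** * Iterated tensors of idempotent formulas *)

Section BigTens.
Variables (T : eqType) (F : T -> fml).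
(** Contraction of [f ⊗ f] to [f] is no rule, and is unsound for formulas not closed under unions,
    so it is assumed of the components. *)
Hypothesis F_idem : forall x, yields (F x ⊗ F x) (F x).
Notation B l := (bigTens (map F l)).

Lemma bigTens_cons x l : yields (B (x :: l)) (F x ⊗ B l).
Proof. by case: l => [|y l] G //= H; apply: d_tensI. Qed.

Lemma tens_bigTens_cons x l : yields (F x ⊗ B l) (B (x :: l)).
Proof. by case: l => [|y l] G //=; apply: d_botE. Qed.

Lemma bigTens_cat l l' : yields (B (l ++ l')) (B l ⊗ B l').
Proof.
elim: l => [|x l IH] G; first by move=> H; apply/d_tensC/d_tensI.
rewrite cat_cons => /bigTens_cons/(yields_tensr IH)/d_tensA.
exact/yields_tensl/tens_bigTens_cons.
Qed.

Lemma tens_bigTens_cat l l' : yields (B l ⊗ B l') (B (l ++ l')).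
Proof.
elim: l => [|x l IH] G; first by move=> /d_tensC/d_botE.
move=> /(yields_tensl (@bigTens_cons _ _))/yields_tens_assoc/(yields_tensr IH).
exact: tens_bigTens_cons.
Qed.

Lemma bigTens_dup x l : x \in l -> yields (B l) (F x ⊗ B l).
Proof.
elim: l => // y l IH; rewrite inE => /predU1P[<-|xl] G.
  move=> /bigTens_cons/(yields_tensl (fun _ => @d_tensW _ _ _))/yields_tens_assoc.
  exact/yields_tensr/tens_bigTens_cons.
move=> /bigTens_cons/(yields_tensr (IH xl))/d_tensA.
move=> /(yields_tensl (fun _ => @d_tensC _ _ _ _))/yields_tens_assoc.
exact/yields_tensr/tens_bigTens_cons.
Qed.

Lemma bigTens_undup x l : x \in l -> yields (F x ⊗ B l) (B l).
Proof.
elim: l => // y l IH; rewrite inE => /predU1P[<-|xl] G.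
  move=> /(yields_tensr (@bigTens_cons _ _))/d_tensA/(yields_tensl (@F_idem _)).
  exact: tens_bigTens_cons.
move=> /(yields_tensr (@bigTens_cons _ _))/d_tensA.
move=> /(yields_tensl (fun _ => @d_tensC _ _ _ _))/yields_tens_assoc.
move=> /(yields_tensr (IH xl)).
exact: tens_bigTens_cons.
Qed.

Lemma bigTens_expand l l' : {subset l' <= l} -> yields (B l) (B (l' ++ l)).
Proof.
elim: l' => [|x l' IH] sl G // H; apply/tens_bigTens_cons/bigTens_dup.
  by rewrite mem_cat sl ?orbT // mem_head.
by apply: IH H => y yl'; apply: sl; rewrite inE yl' orbT.
Qed.

Lemma bigTens_collapse l l' : {subset l' <= l} -> yields (B (l' ++ l)) (B l).
Proof.
elim: l' => [|x l' IH] sl G // /bigTens_cons H.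
apply: IH; first by move=> y yl'; apply: sl; rewrite inE yl' orbT.
by apply: bigTens_undup H; rewrite mem_cat sl ?orbT // mem_head.
Qed.

(** Duplication pads [l] to [l' ++ l], commutation turns this into [l ++ l'], and idempotence
    absorbs [l] into [l']. *)
Lemma bigTens_eq_mem l l' : l =i l' -> yields (B l) (B l').
Proof.
move=> ll' G H; apply: (@bigTens_collapse _ l) => [x|]; first by rewrite ll'.
apply/tens_bigTens_cat/d_tensC/bigTens_cat/bigTens_expand => // x.
by rewrite ll'.
Qed.

Lemma bigTensE l a :
  classical a -> (forall x, x \in l -> yields (F x) a) -> yields (B l) a.
Proof.
move=> ca; elim: l => [_|x l IH Fa].
  (* The empty tensor is [Bot], which yields [a] because classical formulas are [NE]-free. *)
  by apply: yields_bot; elim: a ca => //= g IHg h IHh /andP[/IHg-> /IHh].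
apply: yields_trans (@bigTens_cons _ _) _.
apply: yields_tensE => //; first by apply: Fa; rewrite mem_head.
by apply: IH => y yl; apply: Fa; rewrite inE yl orbT.
Qed.

End BigTens.

(** * The formulas [Theta] of teams on a finite index set *)

Section Teams.
Variable N : set nat.
Hypothesis finN : finite_set N.
Implicit Types (s : valuation N) (X Y Z : team N).

Definition Conj s : fml :=
  foldr (@And _) NE [seq literal L (val i) (s i) | i <- fset_set [set: N]].

Lemma ConjNE s : yields (Conj s) NE.
Proof.
rewrite /Conj; move: (enum_fset _).
by elim=> // i r IH G /d_andEr/IH.
Qed.

Lemma Conj_literal s i : N i -> yields (Conj s) (literal L i (value s i)).
Proof.
move=> Ni; pose j : N := SigSub (mem_set Ni).
rewrite -[i]/(val j) value_val.
have : j \in enum_fset (fset_set [set: N]).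
  rewrite -[_ \in _]/(j \in fset_set _) in_fset_set ?in_setT //.
  exact: finite_setT_sub.
rewrite /Conj; elim: (enum_fset _) => // k r IH.
rewrite inE => /predU1P[<-|jr] G; first exact: d_andEl.
by move=> /d_andEr/(IH jr).
Qed.

Lemma classical_literal i b : classical (literal L i b).
Proof. by case: b. Qed.

(** Each literal is classical and so survives tensor elimination, while [NE] survives by
    [yields_tensNE]; the conjunction is then reassembled. *)
Lemma Conj_idem s : yields (Conj s ⊗ Conj s) (Conj s).
Proof.
have := @yields_tensNE (Conj s) (Conj s) (@ConjNE s).
have : forall i, i \in enum_fset (fset_set [set: N]) ->
    yields (Conj s ⊗ Conj s) (literal L (val i) (s i)).
  move=> i _; have := @Conj_literal s (val i) (set_mem (valP i)).
  by rewrite value_val => H; apply: yields_tensE; rewrite ?classical_literal.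
(* The source is generalised so that the induction unfolds only the conjunction to be rebuilt. *)
move: (Conj s ⊗ Conj s) => f; rewrite /Conj.
elim: (enum_fset _) => // i r IH Hr fNE G H /=.
apply: d_andI; first by apply: Hr H; rewrite mem_head.
by apply: IH H => // j jr; apply: Hr; rewrite inE jr orbT.
Qed.

Lemma ThetaE X : Theta L X = bigTens (map Conj (enum_fset (fset_set X))).
Proof. by []. Qed.

Lemma mem_enum_team X s : (s \in enum_fset (fset_set X)) = (s \in X).
Proof. by rewrite -[LHS]/(s \in fset_set X) in_fset_set //; apply: finite_team. Qed.

Lemma Theta_set0 : Theta L (set0 : team N) = Bot.
Proof. by rewrite /Theta fset_set0. Qed.

Lemma enum_teamU Y Z :
  enum_fset (fset_set (Y `|` Z)) =i
  enum_fset (fset_set Y) ++ enum_fset (fset_set Z).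
Proof. by move=> s; rewrite mem_cat !mem_enum_team in_setU. Qed.

Lemma ThetaU Y Z : yields (Theta L (Y `|` Z)) (Theta L Y ⊗ Theta L Z).
Proof.
rewrite !ThetaE; apply: yields_trans (@bigTens_cat _ _ _ _).
by apply: bigTens_eq_mem; [exact: Conj_idem|exact: enum_teamU].
Qed.

Lemma tens_Theta Y Z : yields (Theta L Y ⊗ Theta L Z) (Theta L (Y `|` Z)).
Proof.
rewrite !ThetaE; apply: yields_trans (@tens_bigTens_cat _ _ _ _) _.
by apply: bigTens_eq_mem; [exact: Conj_idem|move=> s; rewrite enum_teamU].
Qed.

Lemma Theta_mem X s : X s -> yields (Theta L X) (Theta L X ⊗ Conj s).
Proof.
move=> Xs G H; apply/d_tensC/bigTens_dup => //.
by rewrite mem_enum_team; apply: mem_set.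
Qed.

Lemma ThetaNE X : X !=set0 -> yields (Theta L X) NE.
Proof.
by move=> [s /Theta_mem Xs]; apply: yields_trans Xs _; apply/yields_tensNE/ConjNE.
Qed.

Lemma Theta_literal X i b :
  N i -> (forall s, X s -> value s i = b) -> yields (Theta L X) (literal L i b).
Proof.
move=> Ni Xb; rewrite ThetaE; apply: bigTensE; first exact: classical_literal.
move=> s; rewrite mem_enum_team => /set_mem/Xb <-; exact: Conj_literal.
Qed.

(** A copy of the disjunct of [s] is split off; distributing the literal over the tensor puts it
    next to its negation and [NE]. *)
Lemma literal_Theta_absurd X i b s :
  N i -> X s -> value s i = ~~ b ->
  yields (literal L i b ∧ Theta L X) (Bot ∧ NE).
Proof.
move=> Ni Xs sb.
apply: (@yields_trans (literal L i b ∧ (Theta L X ⊗ Conj s))).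
  by apply: yields_and => //; apply: Theta_mem.
apply: distr_absurd; first exact: classical_literal.
move=> G H; apply: d_andI; last exact/ConjNE/(d_andEr H).
have := Conj_literal Ni (d_andEr H); rewrite sb; move: (d_andEl H).
by case: b {sb H} => /= ? ?; apply: (@d_contradiction _ _ i); apply: d_andI.
Qed.

Lemma Theta_sat f X : vars f `<=` N -> sat X f -> yields (Theta L X) f.
Proof.
elim: f X => [i|i|||a|g IHg h IHh|g IHg h IHh] X /= fN.
- by apply: (@Theta_literal _ _ true); apply: fN.
- by apply: (@Theta_literal _ _ false); apply: fN.
- by move->; rewrite Theta_set0.
- by move=> /eqP/set0P/ThetaNE.
- by move=> Xa G; apply: d_atomI.
- move: fN; rewrite subUset => -[gN hN] [Xg Xh] G H.
  by apply: d_andI; [apply: IHg H|apply: IHh H].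
- move: fN; rewrite subUset => -[gN hN] [Y [Z [-> [Yg Zh]]]].
  apply: yields_trans (@ThetaU _ _) _.
  by apply: yields_tens; [apply: IHg|apply: IHh].
Qed.

(** Literals have no strong elimination rule of their own. Strong elimination 2 adjoins [Bot] or
    [NE]; in the second case strong elimination 1 turns [NE] into some [Theta Y], and the teams
    violating the literal are contradictory. *)
Lemma literal_elim i b c h :
  N i ->
  (forall Y, (forall s, Y s -> value s i = b) -> yields (fill c (Theta L Y)) h) ->
  yields (fill c (literal L i b)) h.
Proof.
move=> Ni cY G H; apply: d_strongE2 H _ _; apply: yields_derives.
  (* The empty team satisfies the literal, and its [Theta] is [Bot]. *)
  apply: (@yields_trans (fill c Bot)).
    by apply: yields_fill => G'; apply: d_andEr.
  by rewrite -Theta_set0; apply: cY.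
move=> G'; rewrite -[_ ∧ NE]/(fill (AndR _ (Hole L)) NE) -fill_comp => H.
apply: d_strongE1 finN H _ => Y _; apply: yields_derives; rewrite fill_comp /=.
have [Yb|] := pselect (forall s, Y s -> value s i = b).
  apply: yields_trans (cY Y Yb).
  by apply: yields_fill => G''; apply: d_andEr.
move=> /existsNP[s /not_implyP[Ys sb]].
apply/absurd_fill/(literal_Theta_absurd Ni Ys).
by case: (value s i) b sb {cY} => -[].
Qed.

(** The induction ranges over all contexts: the left component is eliminated with the right one in
    its context, then the right one beside the [Theta Y] obtained. *)
Lemma Theta_elim f c h :
  vars f `<=` N -> (forall Y, sat Y f -> yields (fill c (Theta L Y)) h) ->
  yields (fill c f) h.
Proof.
elim: f c h => [i|i|||a|g IHg k IHk|g IHg k IHk] c h /= fN cY.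
- by apply: (@literal_elim _ true) => //; apply: fN.
- by apply: (@literal_elim _ false) => //; apply: fN.
- by rewrite -Theta_set0; apply: cY.
- by move=> G H; apply: d_strongE1 finN H _ => Y Y0; apply/yields_derives/cY.
- by move=> G H; apply: d_atomE finN fN H _ => Y Ya; apply/yields_derives/cY.
- move: fN; rewrite subUset => -[gN kN].
  rewrite -[g ∧ k]/(fill (AndL (Hole L) k) g) -fill_comp.
  apply: IHg => // Y Yg; rewrite fill_comp /=.
  rewrite -[_ ∧ k]/(fill (AndR (Theta L Y) (Hole L)) k) -fill_comp.
  apply: IHk => // Z Zk; rewrite fill_comp /=.
  (* Distinct teams on [N] contradict each other, so a single team satisfies both conjuncts. *)
  have [YZ|YZ] := pselect (Y = Z); last first.
    by apply: absurd_fill => G; apply: d_ThetaCtr.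
  rewrite -YZ in Zk *; apply: yields_trans (cY _ (conj Yg Zk)).
  by apply: yields_fill => G; apply: d_andEl.
- move: fN; rewrite subUset => -[gN kN].
  rewrite -[g ⊗ k]/(fill (TensL (Hole L) k) g) -fill_comp.
  apply: IHg => // Y Yg; rewrite fill_comp /=.
  rewrite -[_ ⊗ k]/(fill (TensR (Theta L Y) (Hole L)) k) -fill_comp.
  apply: IHk => // Z Zk; rewrite fill_comp /=.
  apply: (@yields_trans (fill c (Theta L (Y `|` Z)))).
    exact/yields_fill/tens_Theta.
  by apply: cY; exists Y, Z.
Qed.

End Teams.
End Derivability.

Theorem theorem5p19 (L : atom_family) (phi psi : formula (atom L)) :
  entails phi psi -> derives (phi :: nil) psi.
Proof.
move=> ent; apply: yields_derives.
have finN : finite_set (vars phi `|` vars psi).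
  by rewrite finite_setU; split; apply: finite_vars.
apply: (@Theta_elim _ _ finN _ (Hole L)); first exact: subsetUl.
move=> X Xphi; apply: (Theta_sat finN); first by move=> i; right.
by apply: ent Xphi; [apply: subsetUl|apply: subsetUr].
Qed.
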